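(* Let $n \geq 1$ and $N = 2^n$. Every DeMorgan circuit computing $\mathrm{MUX}_n$ has size at least $2N + \log N - 2$ (i.e. at least $2\cdot 2^n + n - 2$).
   Context: A DeMorgan circuit is a Boolean circuit whose gates are binary AND gates, binary OR gates, and (unary) NOT gates. The size of a circuit is the number of its binary gates (NOT gates are not counted). The multiplexer $\mathrm{MUX}_n : \{0,1\}^n \times \{0,1\}^{2^n} \to \{0,1\}$ takes $n$ address bits $\vec a = (a_1,\dots,a_n)$ and $2^n$ data bits $\vec x = (x_1,\dots,x_{2^n})$ and outputs the data bit $x_{(\vec a)+1}$, where $(\vec a)$ denotes the integer whose base-2 representation is $\vec a$. Logarithms are base 2. *)

(* Defs.v *)
From mathcomp Require Import all_boot.

Set Implicit Arguments.
Unset Strict Implicit.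
Unset Printing Implicit Defensive.

(* A circuit over a type V of input variables is a DAG presented in
   topological order: [gates] lists its gates, and [Node i] is the wire carrying
   the output of the gate in position i of that list. Fan-out is unrestricted
   and there are no constant wires. *)
Inductive wire (V : Type) : Type :=
  | Input of V
  | Node of nat.

Arguments Node {V}.

Inductive gate (V : Type) : Type :=
  | And of wire V & wire V
  | Or of wire V & wire V
  | Not of wire V.

Definition wire_below V (k : nat) (w : wire V) : bool :=
  if w is Node i then i < k else true.

Definition gate_below V (k : nat) (g : gate V) : bool :=
  match g with
  | And u v | Or u v => wire_below k u && wire_below k v
  | Not u => wire_below k u
  end.

(* The gates of gs, numbered from k on, only read wires of smaller number. *)
Fixpoint wf_gates V (k : nat) (gs : seq (gate V)) : bool :=
  if gs is g :: gs' then gate_below k g && wf_gates k.+1 gs' else true.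

Record circuit (V : Type) : Type := Circuit {
  gates : seq (gate V);
  output : wire V;
  gates_wf : wf_gates 0 gates;
  output_wf : wire_below (size gates) output
}.

Definition is_binary V (g : gate V) : bool := if g is Not _ then false else true.

Definition circuit_size V (C : circuit V) : nat := count (@is_binary V) (gates C).

(* Here s holds the values of the gates already evaluated; well-formedness
   keeps [nth] in range, so its default value is never read. *)
Definition wire_val V (x : V -> bool) (s : seq bool) (w : wire V) : bool :=
  match w with
  | Input v => x v
  | Node i => nth false s i
  end.

Definition gate_val V (x : V -> bool) (s : seq bool) (g : gate V) : bool :=
  match g with
  | And u v => wire_val x s u && wire_val x s v
  | Or u v => wire_val x s u || wire_val x s v
  | Not u => ~~ wire_val x s u
  end.

Definition gate_vals V (x : V -> bool) (gs : seq (gate V)) : seq bool :=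
  foldl (fun s g => rcons s (gate_val x s g)) [::] gs.

Definition circuit_eval V (C : circuit V) (x : V -> bool) : bool :=
  wire_val x (gate_vals x (gates C)) (output C).

(* Base-2 value of (a_1, ..., a_n), with a_1 the most significant bit;
   a_1 is [tnth a i] for i = 0. *)
Definition bin_val n (a : n.-tuple bool) : nat :=
  \sum_(i < n) tnth a i * 2 ^ (n - i.+1).

Lemma bin_val_ltn n (a : n.-tuple bool) : bin_val a < 2 ^ n.
Proof.
have H m (f : 'I_m -> bool) : \sum_(i < m) f i * 2 ^ i < 2 ^ m.
  elim: m f => [|m IHm] f; first by rewrite big_ord0.
  rewrite big_ord_recr /= expnS mul2n -addnn -addSn.
  apply: leq_add; first exact: IHm.
  by case: (f ord_max); rewrite ?mul1n ?mul0n.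
rewrite /bin_val (reindex_inj rev_ord_inj) /=.
under eq_bigr => i _ do rewrite subnSK // subKn ?(ltnW (ltn_ord i)) //.
exact: H.
Qed.

(* The data bits x_1, ..., x_(2^n) are stored from position 0 on, so position
   [bin_val a] of x holds x_((a)+1). *)
Definition MUX n (a : n.-tuple bool) (x : (2 ^ n).-tuple bool) : bool :=
  tnth x (Ordinal (bin_val_ltn a)).

Definition mux_var (n : nat) : Type := ('I_n + 'I_(2 ^ n))%type.

Definition mux_input n (a : n.-tuple bool) (x : (2 ^ n).-tuple bool)
    (v : mux_var n) : bool :=
  match v with
  | inl i => tnth a i
  | inr j => tnth x j
  end.

Definition computes_MUX n (C : circuit (mux_var n)) : Prop :=
  forall (a : n.-tuple bool) (x : (2 ^ n).-tuple bool),
    circuit_eval C (mux_input a x) = MUX a x.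

(* Main.v *)
Require Import Defs.
From mathcomp Require Import all_boot.
From mathcomp Require Import zify.

Set Implicit Arguments.
Unset Strict Implicit.
Unset Printing Implicit Defensive.

(* Gate elimination. Fix all data bits outside a nonempty set S of addresses to
   constants; a circuit for the resulting function has at least 2|S| + n - 2
   binary gates, by induction on |S|. If |S| >= 2, pick i in S. The data bit x_i
   must feed a binary gate, and if it feeds only one gate G, then some value of
   x_i makes G constant; as the restricted function is not constant, G is not
   the output and must feed another binary gate. Either way some value of x_i
   removes two gates. If S = {i}, then the function depends on x_i and on all n
   address bits, so n gates are needed. *)

(** * Boolean functions, restrictions and chains of AND gates *)

Section Chains.

Variable V : finType.

Notation assignment := {ffun V -> bool}.
Notation bfun := {ffun {ffun V -> bool} -> bool}.

Definition bneg (f : bfun) : bfun := [ffun a => ~~ f a].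
Definition band (f g : bfun) : bfun := [ffun a => f a && g a].
Definition bcst (c : bool) : bfun := [ffun => c].
Definition bproj (v : V) : bfun := [ffun a : assignment => a v].

Definition update (a : assignment) v b : assignment :=
  [ffun w => if w == v then b else a w].
Definition restr v b (f : bfun) : bfun := [ffun a => f (update a v b)].

Lemma bnegK : involutive bneg.
Proof. by move=> f; apply/ffunP=> a; rewrite !ffunE negbK. Qed.

Lemma restr_neg v b f : restr v b (bneg f) = bneg (restr v b f).
Proof. by apply/ffunP=> a; rewrite !ffunE. Qed.

Lemma restr_and v b f g : restr v b (band f g) = band (restr v b f) (restr v b g).
Proof. by apply/ffunP=> a; rewrite !ffunE. Qed.

Lemma restr_cst v b c : restr v b (bcst c) = bcst c.
Proof. by apply/ffunP=> a; rewrite !ffunE. Qed.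

Lemma restr_proj v b : restr v b (bproj v) = bcst b.
Proof. by apply/ffunP=> a; rewrite !ffunE eqxx. Qed.

Lemma restr_proj_neq v b w : w != v -> restr v b (bproj w) = bproj w.
Proof. by move=> /negbTE wv; apply/ffunP=> a; rewrite !ffunE wv. Qed.

Lemma bneg_cst c : bneg (bcst c) = bcst (~~ c).
Proof. by apply/ffunP=> a; rewrite !ffunE. Qed.

Lemma band_cstl c f : band (bcst c) f = if c then f else bcst false.
Proof. by case: c; apply/ffunP=> a; rewrite !ffunE. Qed.

Lemma band_cstr c f : band f (bcst c) = if c then f else bcst false.
Proof. by case: c; apply/ffunP=> a; rewrite !ffunE ?andbT ?andbF. Qed.

(** The negation enters together with [f], so NOT gates never cost a step of a chain. *)
Definition adjoin (B : bfun -> Prop) f h := [\/ B h, h = f | h = bneg f].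

(* [chain k B g]: g is computable from B with k AND gates and free negations;
   an OR gate is the negation of an AND gate. *)
Fixpoint chain k (B : bfun -> Prop) (g : bfun) : Prop :=
  if k is k'.+1
  then exists u v, [/\ B u, B v & chain k' (adjoin B (band u v)) g]
  else B g.

(** Constants are included because fixing an input turns wires into constants. *)
Definition basis (B : bfun -> Prop) :=
  (forall c, B (bcst c)) /\ (forall f, B f -> B (bneg f)).

Definition fixes v (f : bfun) := forall b, restr v b f = f.

Lemma adjoin_sub (B B' : bfun -> Prop) f h :
  (forall e, B e -> B' e) -> adjoin B f h -> adjoin B' f h.
Proof. by move=> sBB' [/sBB'|->|->]; [apply: Or31|apply: Or32|apply: Or33]. Qed.

Lemma adjoinC B f g h : adjoin (adjoin B f) g h -> adjoin (adjoin B g) f h.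
Proof.
case=> [[Bh|->|->]|->|->]; first exact/Or31/Or31; first exact: Or32;
  first exact: Or33; first exact/Or31/Or32; exact/Or31/Or33.
Qed.

Lemma basis_adjoin B f : basis B -> basis (adjoin B f).
Proof.
move=> [Bc Bn]; split=> [c|h]; first exact/Or31/Bc.
case=> [Bh|->|->]; first exact/Or31/Bn; first exact: Or33.
by rewrite bnegK; apply: Or32.
Qed.

(** An AND with a constant operand is either false or its other operand: this is how a gate gets
    eliminated. *)
Lemma basis_and B f g : basis B -> B f -> B g ->
  (exists c, f = bcst c \/ g = bcst c) -> B (band f g).
Proof.
move=> [Bc _] Bf Bg [c [->|->]]; rewrite ?band_cstl ?band_cstr; case: c => //.
Qed.

Lemma chain_sub k (B B' : bfun -> Prop) g :
  (forall h, B h -> B' h) -> chain k B g -> chain k B' g.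
Proof.
elim: k B B' => [|k IHk] B B' sBB' /=; first exact: sBB'.
move=> [u [v [Bu Bv Cg]]]; exists u, v; split; [exact: sBB'..|].
by apply: IHk Cg => h; apply: adjoin_sub.
Qed.

Lemma chain_restr v b k (B B' : bfun -> Prop) g :
  (forall h, B h -> B' (restr v b h)) -> chain k B g -> chain k B' (restr v b g).
Proof.
elim: k B B' => [|k IHk] B B' sBB' /=; first exact: sBB'.
move=> [f [h [Bf Bh Cg]]]; exists (restr v b f), (restr v b h).
split; [exact: sBB'..|]; rewrite -restr_and; apply: IHk Cg => e.
by case=> [/sBB' ?|->|->]; rewrite ?restr_neg; [apply: Or31|apply: Or32|apply: Or33].
Qed.

(** * Eliminating gates by fixing one input *)

Lemma fixes_adjoin v (B : bfun -> Prop) f g : (forall h, B h -> fixes v h) ->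
  B f -> B g -> forall h, adjoin B (band f g) h -> fixes v h.
Proof.
move=> fixB Bf Bg h.
by case=> [/fixB //|->|->] b; rewrite ?restr_neg restr_and !fixB.
Qed.

Lemma restr_adjoin v b B f : basis B -> B (restr v b f) ->
  (forall h, B h -> fixes v h) -> forall h, adjoin B f h -> B (restr v b h).
Proof.
move=> [_ Bn] Bf fixB h.
by case=> [Bh|->|->]; [rewrite fixB|exact: Bf|rewrite restr_neg; apply: Bn].
Qed.

(* G is the gate fed by the input v; it becomes constant for v := b0, which
   then removes the first gate reading v or G. *)
Lemma chain_elim1 v (G : bfun) b0 c0 k B g :
    basis B -> (forall h, B h -> fixes v h) -> (forall b, B (restr v b G)) ->
    restr v b0 G = bcst c0 -> chain k (adjoin (adjoin B (bproj v)) G) g ->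
  [\/ fixes v g, exists b c, restr v b g = bcst c
    | exists b k', k' < k /\ chain k' B (restr v b g)].
Proof.
move=> + + + G0; elim: k B => [|k IHk] B basB fixB BG /=.
  case=> [[/fixB|->|->]|->|->]; first exact: Or31.
  - by apply: Or32; exists true, true; rewrite restr_proj.
  - by apply: Or32; exists true, false; rewrite restr_neg restr_proj bneg_cst.
  - by apply: Or32; exists b0, c0.
  - by apply: Or32; exists b0, (~~ c0); rewrite restr_neg G0 bneg_cst.
have member h : adjoin (adjoin B (bproj v)) G h ->
    B (restr v b0 h) /\ (B h \/ exists c, restr v b0 h = bcst c).
  case: (basB) => [Bc Bn]; case=> [[Bh|->|->]|->|->];
    rewrite ?restr_neg ?restr_proj ?G0 ?bneg_cst; split; try exact: Bc;
    try by right; eexists.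
    by rewrite fixB.
  by left.
move=> [f [h [Bf Bh Cg]]].
have [[Bf0 Bf1] [Bh0 Bh1]] := (member _ Bf, member _ Bh).
have elim : (exists c, restr v b0 f = bcst c \/ restr v b0 h = bcst c) ->
    exists b k', k' < k.+1 /\ chain k' B (restr v b g).
  move=> cst; exists b0, k; split=> //; apply: chain_restr Cg => e.
  case=> [/member[]//|->|->]; rewrite ?restr_neg restr_and;
    first exact: basis_and.
  by case: (basB) => _; apply; apply: basis_and.
case: Bf1 => [Bf1|[c fc]]; last by apply/Or33/elim; exists c; left.
case: Bh1 => [Bh1|[c hc]]; last by apply/Or33/elim; exists c; right.
(* This gate reads neither [v] nor [G], so it can be moved below both and absorbed into the
   basis. *)
have: chain k (adjoin (adjoin (adjoin B (band f h)) (bproj v)) G) g.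
  by apply: chain_sub Cg => e /adjoinC; apply: adjoin_sub => {}e; apply: adjoinC.
case/IHk; first exact: basis_adjoin; first exact: fixes_adjoin.
- by move=> b; apply: Or31.
- exact: Or31.
- exact: Or32.
move=> [b [k' [ltk' Ck']]]; apply: Or33; exists b, k'.+1; split=> //.
by exists f, h.
Qed.

(** The first gate reading [v] disappears for either value of [v], and one value makes it constant;
    [chain_elim1] then removes a second gate. Gates before it are absorbed into the basis. *)
Lemma chain_elim2 v k B g :
    basis B -> (forall h, B h -> fixes v h) -> chain k (adjoin B (bproj v)) g ->
  [\/ fixes v g, exists b c, restr v b g = bcst c
    | exists b k', k' + 2 <= k /\ chain k' B (restr v b g)].
Proof.
elim: k B => [|k IHk] B basB fixB /=.
  case=> [/fixB|->|->]; first exact: Or31.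
  - by apply: Or32; exists true, true; rewrite restr_proj.
  - by apply: Or32; exists true, false; rewrite restr_neg restr_proj bneg_cst.
(* The bit [s] records the polarity: [h] is [v] xor [s], hence false for [v := s]. *)
have member h : adjoin B (bproj v) h ->
    B h \/ exists s, forall b, restr v b h = bcst (b (+) s).
  case=> [?|->|->]; first by left.
  - by right; exists false => b; rewrite restr_proj addbF.
  - by right; exists true => b; rewrite restr_neg restr_proj bneg_cst addbT.
move=> [f [h [Bf Bh Cg]]].
have elim : (exists s, (forall b, restr v b f = bcst (b (+) s)) \/
                       (forall b, restr v b h = bcst (b (+) s))) ->
    [\/ fixes v g, exists b c, restr v b g = bcst c
      | exists b k', k' + 2 <= k.+1 /\ chain k' B (restr v b g)].
  move=> [s fhs]; have Bproj b : B (restr v b (bproj v)).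
    by rewrite restr_proj; case: basB.
  have Bfh b : B (restr v b (band f h)).
    rewrite restr_and; apply: basis_and => //; try exact: restr_adjoin.
    by exists (b (+) s); case: fhs => ->; [left|right].
  have fh0 : restr v s (band f h) = bcst false.
    by rewrite restr_and; case: fhs => ->; rewrite addbb ?band_cstl ?band_cstr.
  case: (chain_elim1 basB fixB Bfh fh0 Cg); [exact: Or31|exact: Or32|].
  move=> [b [k' [ltk' Ck']]]; apply: Or33; exists b, k'; split=> //; lia.
case: (member _ Bf) => [Bf1|[s fs]]; last by apply: elim; exists s; left.
case: (member _ Bh) => [Bh1|[s hs]]; last by apply: elim; exists s; right.
have: chain k (adjoin (adjoin B (band f h)) (bproj v)) g.
  by apply: chain_sub Cg => e; apply: adjoinC.
case/IHk; first exact: basis_adjoin; first exact: fixes_adjoin.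
- exact: Or31.
- exact: Or32.
move=> [b [k' [ltk' Ck']]]; apply: Or33; exists b, k'.+1; split=> //.
by exists f, h.
Qed.

Definition literal (f : bfun) : Prop :=
  (exists c, f = bcst c) \/ exists v, f = bproj v \/ f = bneg (bproj v).

Lemma basis_literal : basis literal.
Proof.
split=> [c|f]; first by left; exists c.
case=> [[c ->]|[v [->|->]]].
- by left; exists (~~ c); rewrite bneg_cst.
- by right; exists v; right.
- by right; exists v; left; rewrite bnegK.
Qed.

(** The literals not involving [v] form a basis fixed by [v]; the remaining ones are [v] and its
    negation. *)
Lemma chain_literal_elim2 v k g : chain k literal g ->
  [\/ fixes v g, exists b c, restr v b g = bcst c
    | exists b k', k' + 2 <= k /\ chain k' literal (restr v b g)].
Proof.
pose B f := literal f /\ fixes v f.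
have basB : basis B.
  have [lc ln] := basis_literal.
  split=> [c|f [lf fixf]]; split; first exact: lc.
  - by move=> b; rewrite restr_cst.
  - exact: ln.
  - by move=> b; rewrite restr_neg fixf.
have fixB h : B h -> fixes v h by case.
move=> Cg; have: chain k (adjoin B (bproj v)) g.
  apply: chain_sub Cg => h lh; case: (lh) => [[c hc]|[w hw]].
    by apply: Or31; split=> // b; rewrite hc restr_cst.
  have [wv|wv] := eqVneq w v; first by rewrite -wv; case: hw; [apply: Or32|apply: Or33].
  by apply: Or31; split=> // b; case: hw => ->; rewrite ?restr_neg restr_proj_neq.
case/(chain_elim2 basB fixB); [exact: Or31|exact: Or32|].
move=> [b [k' [lek' Ck']]]; apply: Or33; exists b, k'; split=> //.
by apply: chain_sub Ck' => h [].
Qed.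

(** * Gate count against number of essential variables *)

(** [W] collects the leaves that determine [g]. Replacing the first gate and its negation among the
    leaves by the two operands adds at most one leaf. *)
Lemma chain_support k B g : chain k B g ->
  exists W : seq bfun, [/\ size W <= k.+1, forall h, h \in W -> B h
    & forall a a' : assignment, {in W, forall h : bfun, h a = h a'} -> g a = g a'].
Proof.
elim: k B => [|k IHk] B /=.
  move=> Bg; exists [:: g]; split=> // [h|a a' -> //]; last exact: mem_head.
  by rewrite inE => /eqP->.
move=> [u [v [Bu Bv /IHk[W [sW WB Wg]]]]]; set f := band u v in WB.
pose p h := (h == f) || (h == bneg f).
have [pW|npW] := boolP (has p W); last first.
  exists W; split=> // [|h hW]; first exact: leqW.
  case: (WB h hW) => // hf; case/hasP: npW; exists h => //;
    by rewrite /p hf eqxx ?orbT.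
exists [:: u, v & filter (predC p) W]; split=> [|h|a a' eqW].
(* The filter drops at least one element of [W], which offsets one of the two new leaves. *)
- move: pW (count_predC p W); rewrite /= has_count size_filter; lia.
- rewrite !inE => /or3P[/eqP->|/eqP->|] //; rewrite mem_filter /p /=.
  by case/andP=> nph /WB[//|hf|hf]; rewrite hf eqxx ?orbT in nph.
- have eqf : f a = f a'.
    by rewrite !ffunE !eqW ?inE ?eqxx ?orbT.
  apply: Wg => h hW; have [ph|nph] := boolP (p h).
    by case/orP: ph => /eqP->; rewrite ?[bneg f _]ffunE eqf.
  by apply: eqW; rewrite !inE mem_filter /= nph hW !orbT.
Qed.

Definition depends (g : bfun) : {set V} :=
  [set v | [exists a : assignment, [exists b, g a != g (update a v b)]]].

Lemma card_depends_literal h : literal h -> #|depends h| <= 1.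
Proof.
case=> [[c ->]|[v hv]].
  rewrite (_ : depends _ = set0) ?cards0 //; apply/setP=> w; rewrite !inE.
  by apply/existsP=> -[a /existsP[b]]; rewrite !ffunE eqxx.
rewrite -(cards1 v) subset_leq_card //; apply/subsetP=> w; rewrite !inE.
case/existsP=> a /existsP[b]; case: hv => ->; rewrite !ffunE (eq_sym w v);
  by case: (v == w) => //; rewrite eqxx.
Qed.

Lemma chain_depends k g : chain k literal g -> #|depends g| <= k.+1.
Proof.
move=> /chain_support[W [sW WB Wg]]; apply: leq_trans sW.
apply: leq_trans (card_size W); rewrite -[#|W|]sum1_card.
have sub : depends g \subset \bigcup_(h in W) depends h.
  apply/subsetP=> v; rewrite inE => /existsP[a /existsP[b gab]].
  have /allPn[h hW hab] : ~~ all (fun h : bfun => h a == h (update a v b)) W.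
    by apply: contra gab => /allP eqW; apply/eqP/Wg=> h /eqW/eqP.
  apply/bigcupP; exists h => //.
  by rewrite inE; apply/existsP; exists a; apply/existsP; exists b.
apply: leq_trans (subset_leq_card sub) _.
elim/big_ind2: _ => [|A m B' p Am Bp|h hW]; first by rewrite cards0.
  by rewrite (leq_trans (leq_card_setU _ _)) // leq_add.
exact/card_depends_literal/WB.
Qed.

(** * From circuits to chains *)

(** Invariant: [B] contains the function computed at every wire evaluated so far, the state [s]
    depending on the assignment. *)
Lemma chain_of_gates (gs : seq (gate V)) (o : wire V) i
    (s : assignment -> seq bool) (B : bfun -> Prop) :
    basis B -> (forall v, B (bproj v)) -> (forall a, size (s a) = i) ->
    (forall j, j < i -> B [ffun a => nth false (s a) j]) ->
    wf_gates i gs -> wire_below (i + size gs) o ->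
  chain (count (@is_binary V) gs) B
    [ffun a : assignment =>
       wire_val a (foldl (fun s g => rcons s (gate_val a s g)) (s a) gs) o].
Proof.
elim: gs i s B => [|g gs IHgs] i s B basB Bproj sizes Bs /=.
  case: o => [v|j] _ /=; last by rewrite addn0; apply: Bs.
  by move=> _; apply: Bproj.
have Bwire w : wire_below i w -> B [ffun a : assignment => wire_val a (s a) w].
  by case: w => [v|j] /=; [move=> _; apply: Bproj|apply: Bs].
case/andP=> gi wfgs; rewrite -addSnnS => wfo.
pose f : bfun := [ffun a : assignment => gate_val a (s a) g].
pose s' (a : assignment) := rcons (s a) (gate_val a (s a) g).
have sizes' a : size (s' a) = i.+1 by rewrite size_rcons sizes.
have Bs' (B' : bfun -> Prop) : (forall h, B h -> B' h) -> B' f ->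
    forall j, j < i.+1 -> B' [ffun a => nth false (s' a) j].
  move=> sBB' B'f j; rewrite ltnS leq_eqVlt => /orP[/eqP->|ltji].
    congr B': B'f; apply/ffunP=> a.
    by rewrite !ffunE nth_rcons sizes ltnn eqxx.
  congr B': (sBB' _ (Bs _ ltji)); apply/ffunP=> a.
  by rewrite !ffunE nth_rcons sizes ltji.
have step u v : B u -> B v -> adjoin B (band u v) f ->
    exists u v, [/\ B u, B v & chain (count (@is_binary V) gs)
      (adjoin B (band u v)) [ffun a : assignment => wire_val a
        (foldl (fun s g => rcons s (gate_val a s g)) (s' a) gs) o]].
  move=> Bu Bv Bf; exists u, v; split=> //.
  apply: (IHgs i.+1 s') => //; first exact: basis_adjoin.
    by move=> w; apply: Or31.
  by apply: Bs' Bf => h; apply: Or31.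
case: (basB) => _ Bn; case: g => [u v|u v|u] in gi f s' sizes' Bs' step *.
- case/andP: gi => /Bwire Bu /Bwire Bv; apply: step Bu Bv _.
  by apply: Or32; apply/ffunP=> a; rewrite !ffunE.
(* De Morgan: the OR is the negation of the AND of the negated operands. *)
- case/andP: gi => /Bwire/Bn Bu /Bwire/Bn Bv; apply: step Bu Bv _.
  by apply: Or33; apply/ffunP=> a; rewrite !ffunE negb_and !negbK.
- apply: (IHgs i.+1 s') => //; apply: Bs' => //.
  by congr B: (Bn _ (Bwire _ gi)); apply/ffunP=> a; rewrite !ffunE.
Qed.

Lemma chain_of_circuit (C : circuit V) :
  chain (circuit_size C) literal [ffun a : assignment => circuit_eval C a].
Proof.
apply: (@chain_of_gates _ _ 0 (fun=> [::])) => //.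
- exact: basis_literal.
- by move=> v; right; exists v; left.
- exact: gates_wf.
- exact: output_wf.
Qed.

End Chains.

(** * Addresses and restricted multiplexers *)

(** The parity of the value is the last bit, and halving leaves the value of the other bits. *)
Lemma bin_val_inj n : injective (@bin_val n).
Proof.
have H m (f g : 'I_m -> bool) :
    \sum_(i < m) f i * 2 ^ (m - i.+1) = \sum_(i < m) g i * 2 ^ (m - i.+1) -> f =1 g.
  elim: m f g => [|m IHm] f g; first by move=> _ [].
  have rec (h : 'I_m.+1 -> bool) : \sum_(i < m.+1) h i * 2 ^ (m.+1 - i.+1) =
      h ord_max + (\sum_(i < m) h (widen_ord (leqnSn m) i) * 2 ^ (m - i.+1)).*2.
    rewrite big_ord_recr /= subnn muln1 addnC -mul2n big_distrr /=.
    congr (_ + _); apply: eq_bigr => i _.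
    by rewrite subSn // expnS mulnCA.
  rewrite !rec => eqfg.
  have eqmax : f ord_max = g ord_max.
    by have := congr1 odd eqfg; rewrite !oddD !odd_double !addbF !oddb.
  move: eqfg; rewrite eqmax => /addnI/double_inj/IHm eqfg i.
  have [[j ->]|->//] : (exists j, i = widen_ord (leqnSn m) j) \/ i = ord_max.
    have [ltim|leim] := ltnP i m; first by left; exists (Ordinal ltim); apply: val_inj.
    by right; apply: val_inj; apply/eqP; rewrite /= eqn_leq leim -ltnS ltn_ord.
  exact: eqfg.
by move=> a b /H eqab; apply: eq_from_tnth.
Qed.

Section Multiplexer.

Variable n : nat.
Notation assignment := {ffun mux_var n -> bool}.

Definition address (a : assignment) : 'I_(2 ^ n) :=
  Ordinal (bin_val_ltn [tuple a (inl i) | i < n]).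

Lemma address_eq (a a' : assignment) :
  address a = address a' -> forall i, a (inl i) = a' (inl i).
Proof.
move=> /(congr1 val)/bin_val_inj eqt i.
by have := congr1 (fun t => tnth t i) eqt; rewrite !tnth_mktuple.
Qed.

Lemma eq_address (a a' : assignment) :
  (forall i, a (inl i) = a' (inl i)) -> address a = address a'.
Proof.
move=> eqa; apply: val_inj; congr bin_val.
by apply: eq_from_tnth => i; rewrite !tnth_mktuple eqa.
Qed.

(** An injection between finite sets of equal size is onto; the data bits are independent of the
    address. *)
Lemma address_surj (j : 'I_(2 ^ n)) (x : 'I_(2 ^ n) -> bool) :
  exists2 a : assignment, address a = j & forall i, a (inr i) = x i.
Proof.
pose F (t : n.-tuple bool) := Ordinal (bin_val_ltn t).
have injF : injective F by move=> t t' /(congr1 val)/bin_val_inj.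
have /inj_card_onto/(_ j) : #|'I_(2 ^ n)| <= #|{:n.-tuple bool}|.
  by rewrite card_tuple card_bool card_ord.
case/(_ _ injF)/codomP=> t ->.
pose a : assignment := [ffun v => match v with inl i => tnth t i | inr i => x i end].
exists a => [|i]; last by rewrite ffunE.
apply: val_inj; congr bin_val.
by apply: eq_from_tnth => i; rewrite tnth_mktuple ffunE.
Qed.

(** All variables stay in the domain, so [S] can shrink in an induction without changing the
    type. *)
Definition mux_restr (S : {set 'I_(2 ^ n)}) (c : 'I_(2 ^ n) -> bool) :
    {ffun assignment -> bool} :=
  [ffun a => if address a \in S then a (inr (address a)) else c (address a)].

Lemma address_update_inr a i b : address (update a (inr i) b) = address a.
Proof. by apply: eq_address => j; rewrite ffunE. Qed.

Lemma restr_mux_restr (S : {set _}) c i b : i \in S ->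
  restr (inr i) b (mux_restr S c) =
  mux_restr (S :\ i) (fun j => if j == i then b else c j).
Proof.
move=> iS; apply/ffunP=> a; rewrite !ffunE address_update_inr in_setD1.
rewrite (inj_eq (@inr_inj _ _)).
by have [->|ne] := eqVneq (address a) i; rewrite ?iS.
Qed.

Lemma depends_mux_restr1 i c : n < #|depends (mux_restr [set i] c)|.
Proof.
have -> : n.+1 = #|(inr i : mux_var n) |: [set (inl k : mux_var n) | k in 'I_n]|.
  rewrite cardsU1 card_imset ?card_ord; last by move=> x y [].
  by rewrite (_ : _ \notin _) //; apply/imsetP=> -[].
apply/subset_leq_card/subsetP=> v; rewrite !inE => /orP[/eqP->|/imsetP[k _ ->]].
  have [a ai ax] := address_surj i (fun=> false).
  apply/existsP; exists a; apply/existsP; exists true.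
  by rewrite !ffunE address_update_inr ai set11 ax eqxx.
(* Flipping address bit [k] leads from [i] to some [j], where [c j] is read. [a0] serves to find [j]
   first; then [a] carries data [~~ c j], so the flip changes the output. *)
have [a0 a0i _] := address_surj i (fun=> false).
pose j := address (update a0 (inl k) (~~ a0 (inl k))).
have [a ai ax] := address_surj i (fun=> ~~ c j).
have aa0 : forall l, a (inl l) = a0 (inl l) by apply: address_eq; rewrite ai.
have aj : address (update a (inl k) (~~ a (inl k))) = j.
  by apply: eq_address => l; rewrite !ffunE !aa0.
have ji : j != i.
  apply/eqP; rewrite -a0i => /address_eq/(_ k); rewrite ffunE eqxx.
  by case: (a0 _).
apply/existsP; exists a; apply/existsP; exists (~~ a (inl k)).
by rewrite !ffunE ai aj set11 in_set1 (negbTE ji) ax; case: (c j).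
Qed.

Lemma mux_restr_chain k (S : {set _}) c : 0 < #|S| ->
  chain k (@literal (mux_var n)) (mux_restr S c) -> 2 * #|S| + n <= k + 2.
Proof.
move cardS: #|S| => m.
elim: m S cardS k c => // m IHm S cardS k c _ Cg.
(* A single remaining address: [n + 1] essential variables force [n] gates. *)
have [m0|m_gt0] := posnP m.
  have /cards1P[i eqS] : #|S| == 1 by rewrite cardS m0.
  have := leq_trans (depends_mux_restr1 i c) (chain_depends _).
  by move=> /(_ k); rewrite -eqS => /(_ Cg); rewrite m0; lia.
have /card_gt0P[i iS] : 0 < #|S| by rewrite cardS.
have cardSi : #|S :\ i| = m by move: (cardsD1 i S); rewrite iS cardS => -[].
have /card_gt0P[j jSi] : 0 < #|S :\ i| by rewrite cardSi.
case: (chain_literal_elim2 (inr i) Cg) => [fixg|[b [d gd]]|[b [k' [lek' Ck']]]].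
- have [a ai _] := address_surj i (fun=> false).
  have gb b : mux_restr S c a = b.
    by rewrite -(fixg b) !ffunE address_update_inr ai iS eqxx.
  by have := gb true; rewrite (gb false).
(* Fixing [x_i] cannot make the function constantly [d]: the second address [j] still reads a free
   data bit. *)
- have [a aj ax] := address_surj j (fun=> ~~ d).
  have := congr1 (fun f : {ffun _ -> _} => f a) gd.
  rewrite restr_mux_restr // !ffunE aj jSi ax.
  by case: (d).
- rewrite restr_mux_restr // in Ck'.
  have := IHm _ cardSi k' _ m_gt0 Ck'; lia.
Qed.

End Multiplexer.

Theorem theorem12 (n : nat) (hn : 1 <= n) (C : circuit (mux_var n))
    (hC : computes_MUX C) :
  2 * 2 ^ n + n - 2 <= circuit_size C.
Proof.
suff eqC : [ffun a : {ffun mux_var n -> bool} => circuit_eval C a] =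
    mux_restr setT (fun=> false).
  move: (chain_of_circuit C); rewrite eqC => /mux_restr_chain.
  by rewrite cardsT card_ord expn_gt0 leq_subLR [2 + _]addnC; apply.
apply/ffunP=> a; rewrite !ffunE inE.
pose t := [tuple a (inl i) | i < n]; pose x := [tuple a (inr i) | i < 2 ^ n].
have eqa : a =1 mux_input t x by case=> i; rewrite /= tnth_mktuple.
have -> : circuit_eval C a = circuit_eval C (mux_input t x).
  (* The two inputs agree only pointwise, so evaluations are compared wire by wire. *)
  have eqw s w : wire_val a s w = wire_val (mux_input t x) s w.
    by case: w => [v|j] //=; apply: eqa.
  rewrite /circuit_eval eqw; congr wire_val; rewrite /gate_vals.
  elim: (gates C) [::] => //= g gs IHgs s; rewrite IHgs; congr foldl.
  by congr rcons; case: g => [u v|u v|u] /=; rewrite !eqw.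
by rewrite hC /MUX tnth_mktuple.
Qed.
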